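(* Let $F$ be a $C^2$ Finsler metric on $\mathbb{R}^2$ that is projective and periodic, i.e. $F(\mathbf{x}+\mathbf{m},\mathbf{v})=F(\mathbf{x},\mathbf{v})$ for all $\mathbf{m}\in\mathbb{Z}^2$. Then $F$ is the sum of a Minkowski norm and the differential of a $C^3$ function on the plane: there exist a Minkowski norm $\|\cdot\|$ on $\mathbb{R}^2$ and a $C^3$ function $f:\mathbb{R}^2\to\mathbb{R}$ with $F(\mathbf{x},\mathbf{v})=\|\mathbf{v}\|+df_{\mathbf{x}}(\mathbf{v})$.
   Context: A Minkowski norm on a finite-dimensional real vector space is a function $\|\cdot\|\ge 0$, $C^2$ outside the origin, vanishing only at $\mathbf{0}$, positively homogeneous of degree one, satisfying the triangle inequality, and such that the Hessian of $\mathbf{x}\mapsto\|\mathbf{x}\|^2$ is positive definite outside the origin. A $C^2$ Finsler metric on $\mathbb{R}^2$ is a continuous $F:T\mathbb{R}^2\to[0,\infty)$, $C^2$ outside the zero section, restricting to a Minkowski norm on each tangent space (not necessarily reversible). It is projective if the parametrized lines $t\mapsto\mathbf{x}+t\mathbf{v}$ solve its Euler–Lagrange equations. *)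

(* Defs.v *)
From HB Require Import structures.
From mathcomp Require Import all_boot all_order all_algebra.
From mathcomp Require Import all_classical all_reals all_analysis.
Set Implicit Arguments. Unset Strict Implicit. Unset Printing Implicit Defensive.
Import Order.TTheory GRing.Theory Num.Theory.
Import numFieldNormedType.Exports.
Local Open Scope classical_set_scope.
Local Open Scope ring_scope.

Section FinslerDefs.
Variable R : realType.

Fixpoint CkOn (V : normedModType R) (k : nat) (U : set V) (f : V -> R) : Prop :=
  match k with
  | 0%N => forall x, U x -> {for x, continuous f}
  | k'.+1 => (forall x, U x -> {for x, continuous f}) /\
             (forall u x, U x -> derivable f x u) /\
             (forall u, CkOn k' U ('D_u f))
  end.

Definition ebase (i : 'I_2) : 'rV[R]_2 := delta_mx 0 i.

Definition hessian (g : 'rV[R]_2 -> R) (x : 'rV[R]_2) : 'M[R]_2 :=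
  \matrix_(i, j) derive (fun y => derive g y (ebase j)) x (ebase i).

Definition posdef (H : 'M[R]_2) : Prop :=
  forall u : 'rV[R]_2, u != 0 -> 0 < (u *m H *m u^T) 0 0.

Definition minkowski_norm (N : 'rV[R]_2 -> R) : Prop :=
  (forall v, 0 <= N v) /\
  (forall v, N v = 0 <-> v = 0) /\
  (forall (c : R) v, 0 < c -> N (c *: v) = c * N v) /\
  (forall u v, N (u + v) <= N u + N v) /\
  CkOn 2 [set v | v != 0] N /\
  (forall v, v != 0 -> posdef (hessian (fun w => N w ^+ 2) v)).

Definition finsler_C2 (F : 'rV[R]_2 -> 'rV[R]_2 -> R) : Prop :=
  [/\ continuous (fun p : 'rV[R]_2 * 'rV[R]_2 => F p.1 p.2),
      CkOn 2 [set p : 'rV[R]_2 * 'rV[R]_2 | p.2 != 0] (fun p => F p.1 p.2) &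
      (forall x, minkowski_norm (F x))].

(* Projective: the lines t |-> x + t v (v <> 0) solve the Euler-Lagrange
   equations  d/dt [dF/dv_i (x + t v, v)] = dF/dx_i (x + t v, v). *)
Definition projective (F : 'rV[R]_2 -> 'rV[R]_2 -> R) : Prop :=
  forall (x v : 'rV[R]_2), v != 0 -> forall (i : 'I_2) (t : R),
    is_derive t 1
      (fun s : R => derive (F (x + s *: v)) v (ebase i))
      (derive (fun y => F y v) (x + t *: v) (ebase i)).

Definition Zperiodic (F : 'rV[R]_2 -> 'rV[R]_2 -> R) : Prop :=
  forall (m : 'rV[int]_2) (x v : 'rV[R]_2),
    F (x + map_mx (fun z : int => z%:~R) m) v = F x v.

End FinslerDefs.

(* Main.v *)
Require Import Defs.
From HB Require Import structures.
From mathcomp Require Import all_boot all_order all_algebra.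
From mathcomp Require Import all_classical all_reals all_analysis.
From mathcomp Require Import ring lra.
Import Order.TTheory GRing.Theory Num.Theory.
Import numFieldNormedType.Exports.
Set Implicit Arguments.
Unset Strict Implicit.
Unset Printing Implicit Defensive.
Local Open Scope classical_set_scope.
Local Open Scope ring_scope.

(** Write [Phi (x, v) = F x v]. In dimension two, the Euler-Lagrange equations
    along lines together with homogeneity amount to Hamel's condition
    [F_(x_i v_j) = F_(x_j v_i)]. Differentiating the equations in [v], Hamel's
    condition shows that the vertical Hessian [F_(v_i v_j)(x, v)] is constant
    along each line [x + t v]; since [F] is only [C^2], this uses the version of
    Schwarz's theorem in which the existence of the second mixed derivative is
    part of the conclusion. Lines of rational slope with large denominator are
    almost dense in the torus, so by periodicity and continuity the vertical
    Hessian does not depend on [x]. Hence [F x v - F 0 v] is linear in [v], i.e.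
    a 1-form, which is closed by Hamel's condition and therefore exact; the
    Minkowski norm is [F 0]. *)

(** * Directional derivatives *)

Section DirectionalDerivatives.
Variables (R : realType).

(** The bound is non-strict so that it survives a passage to the limit. *)
Lemma is_derive_normP (V : normedModType R) (f : V -> R) (x v : V) (l : R) :
  is_derive x v f l <->
  forall e : R, 0 < e ->
    \forall h \near 0^', `|h^-1 * (f (x + h *: v) - f x) - l| <= e.
Proof.
have E : (fun h : R => h^-1 *: ((f \o shift x) (h *: v) - f x)) =
         (fun h : R => h^-1 * (f (x + h *: v) - f x)).
  by apply/funext => h; rewrite /= [_ *: v + x]addrC.
split=> [[df <-] e e0|H].
  move: df; rewrite /derivable /derive E => /cvgrPdist_le /(_ _ e0).
  by apply: filterS => h; rewrite distrC.
have cv : (fun h : R => h^-1 *: ((f \o shift x) (h *: v) - f x)) @ 0^' --> l.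
  rewrite E; apply/cvgrPdist_le => e /H.
  by apply: filterS => h; rewrite distrC.
split; first by apply/cvg_ex; exists l.
by apply/cvg_lim.
Qed.

(** The two difference quotients coincide after regrouping. This carries directional derivatives
    over to functions of one real variable, where the mean value theorem applies. *)
Lemma is_derive_lineP (V : normedModType R) (f : V -> R) (x v : V) (t l : R) :
  is_derive (x + t *: v) v f l <-> is_derive t 1 (fun s : R => f (x + s *: v)) l.
Proof.
rewrite !is_derive_normP; split=> H e /H; apply: filterS => h.
  by rewrite /= scalerDl -[h%:A]/(h * 1) mulr1 addrA.
by rewrite /= scalerDl -[h%:A]/(h * 1) mulr1 addrA.
Qed.

Lemma is_derive_line0P (V : normedModType R) (f : V -> R) (x v : V) (l : R) :
  is_derive x v f l <-> is_derive (0 : R) 1 (fun s : R => f (x + s *: v)) l.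
Proof. by rewrite -is_derive_lineP scale0r addr0. Qed.

(** Differentiability on the symmetric interval around [a] covers both orders of [a] and [b], which
    spares later proofs a case distinction on the sign of an increment. *)
Lemma mean_value (f df : R -> R) (a b : R) :
  (forall x, `|x - a| <= `|b - a| -> is_derive x 1 f (df x)) ->
  exists2 c, `|c - a| <= `|b - a| & f b - f a = df c * (b - a).
Proof.
move=> fd.
have cont c d : (forall x, x \in `[c, d]%R -> `|x - a| <= `|b - a|) ->
    {within `[c, d], continuous f}.
  move=> H; apply: derivable_within_continuous => x /H /fd h.
  exact: ex_derive.
have [ab|ba] := leP a b.
  have ok x : x \in `[a, b]%R -> `|x - a| <= `|b - a|.
    by rewrite in_itv/= => /andP[ax xb]; rewrite !ger0_norm ?subr_ge0 ?lerB.
  have [c cab E] := MVT_segment ab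
    (fun x xab => fd x (ok x (subset_itv_oo_cc xab))) (cont _ _ ok).
  by exists c => //; exact: ok.
have ok x : x \in `[b, a]%R -> `|x - a| <= `|b - a|.
  rewrite in_itv/= => /andP[ax xb].
  by rewrite !ler0_norm ?subr_le0 ?(ltW ba)// lerN2 lerB.
have [c cab E] := MVT_segment (ltW ba)
  (fun x xab => fd x (ok x (subset_itv_oo_cc xab))) (cont _ _ ok).
exists c; first exact: ok.
by rewrite -[f b - f a]opprB E -mulrN opprB.
Qed.

Lemma mean_value_line (V : normedModType R) (f df : V -> R) (x v : V) (h : R) :
  (forall s, `|s| <= `|h| -> is_derive (x + s *: v) v f (df (x + s *: v))) ->
  exists2 c, `|c| <= `|h| & f (x + h *: v) - f x = df (x + c *: v) * h.
Proof.
move=> fd.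
have [s|c cab E] := @mean_value (fun s : R => f (x + s *: v))
    (fun s : R => df (x + s *: v)) 0 h.
  by rewrite !subr0 => /fd /is_derive_lineP.
exists c; first by move: cab; rewrite !subr0.
by move: E; rewrite !scale0r addr0 subr0.
Qed.

Lemma is_deriveZdir (V : normedModType R) (f : V -> R) (x v : V) (c l : R) :
  is_derive x v f l -> is_derive x (c *: v) f (c * l).
Proof.
move=> /is_derive_line0P H; apply/is_derive_line0P.
rewrite (_ : (fun s => _) = (fun s : R => f (x + s *: v)) \o (fun s => c * s)); last first.
  by apply/funext => s /=; rewrite scalerA mulrC.
have H1 : is_derive (c * 0) 1 (fun s : R => f (x + s *: v)) l by rewrite mulr0.
have H2 : is_derive (0 : R) 1 (fun s : R => c * s) c.
  by apply: is_derive_eq; rewrite -[_%:A]/(_ * _) mulr1.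
have := is_derive1_comp H1 H2.
by rewrite mulrC.
Qed.

(** Go from [x] to [x + h u], then to [x + h u + h v]. The first leg contributes [l] by definition;
    by the mean value theorem the second contributes [df] at a point close to [x], hence [df x] in
    the limit by continuity. *)
Lemma is_deriveDdir (V : normedModType R) (f df : V -> R) (x u v : V) (l : R) :
  is_derive x u f l -> (\forall y \near x, is_derive y v f (df y)) ->
  {for x, continuous df} ->
  is_derive x (u + v) f (l + df x).
Proof.
move=> /is_derive_normP fu fv cf; apply/is_derive_normP => e e0.
have e20 : 0 < e / 2 by rewrite divr_gt0.
have near2 : \forall y \near x, is_derive y v f (df y) /\ `|df x - df y| <= e / 2.
  apply: filterI => //.
  by move/cvgrPdist_le : cf => /(_ _ e20).
move/nbhs_ballP : near2 => [d /= d0 near2].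
have M0 : 0 < `|u| + `|v| + 1 by rewrite ltr_wpDl// addr_ge0.
(* For [h] below this radius, both legs stay in the ball of radius [d]; the summand 1 keeps the
   denominator positive. *)
have d'0 : 0 < d / (`|u| + `|v| + 1) by rewrite divr_gt0.
near=> h.
have hd : `|h| < d / (`|u| + `|v| + 1).
  by near: h; apply: dnbhs0_lt.
have h0 : h != 0 by near: h; exact: nbhs_dnbhs_neq.
have inb c : `|c| <= `|h| -> ball x d (x + h *: u + c *: v).
  move=> ch; rewrite -ball_normE /= -addrA opprD addrA subrr sub0r normrN.
  apply: le_lt_trans (ler_normD _ _) _; rewrite !normrZ.
  apply: (@le_lt_trans _ _ (`|h| * (`|u| + `|v| + 1))); last by rewrite -ltr_pdivlMr.
  by have := ler_wpM2r (normr_ge0 v) ch; have := normr_ge0 h; lra.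
have [c ch E] : exists2 c, `|c| <= `|h| &
    f (x + h *: u + h *: v) - f (x + h *: u) = df (x + h *: u + c *: v) * h.
  by apply: mean_value_line => s sh; have [] := near2 _ (inb _ sh).
have -> : h^-1 * (f (x + h *: (u + v)) - f x) - (l + df x) =
  (h^-1 * (f (x + h *: u) - f x) - l) + (df (x + h *: u + c *: v) - df x).
  rewrite scalerDr addrA -(subrK (f (x + h *: u)) (f (x + h *: u + h *: v))) E.
  by field.
rewrite [leRHS]splitr; apply: le_trans (ler_normD _ _) _; apply: lerD.
  by near: h; exact: fu.
by rewrite distrC; have [] := near2 _ (inb _ ch).
Unshelve. all: by end_near. Qed.

(* Only [g2 s = d/dt g(s, t) at t = 0] is assumed to exist; its
   differentiability is part of the conclusion. *)
Lemma strong_schwarz (g g1 g12 : R -> R -> R) (g2 : R -> R) (d : R) :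
  0 < d ->
  (forall s t : R, `|s| < d -> `|t| < d -> is_derive s 1 (g^~ t) (g1 s t)) ->
  (forall s t : R, `|s| < d -> `|t| < d -> is_derive t 1 (g1 s) (g12 s t)) ->
  (forall s : R, `|s| < d -> is_derive (0 : R) 1 (g s) (g2 s)) ->
  (forall e : R, 0 < e -> exists2 r : R, 0 < r &
     forall s t : R, `|s| < r -> `|t| < r -> `|g12 s t - g12 0 0| <= e) ->
  is_derive (0 : R) 1 g2 (g12 0 0).
Proof.
move=> d0 H1 H12 H2 cg; apply/is_derive_normP => e e0.
have [r r0 Hr] := cg _ e0.
near=> s.
have sd : `|s| < d by near: s; exact: dnbhs0_lt.
have sr : `|s| < r by near: s; exact: dnbhs0_lt.
have s0 : s != 0 by near: s; exact: nbhs_dnbhs_neq.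
(* The mixed second difference quotient is [g12] at an intermediate point: apply the mean value
   theorem in the first variable, then in the second. *)
have key t : t != 0 -> `|t| < d -> `|t| < r ->
  `|s^-1 * (t^-1 * (g s t - g s 0) - t^-1 * (g 0 t - g 0 0)) - g12 0 0| <= e.
  move=> t0 td tr.
  have [x|c] := @mean_value (fun x => g x t - g x 0) (fun x => g1 x t - g1 x 0) 0 s.
    rewrite !subr0 => xs; have xd := le_lt_trans xs sd.
    by apply: is_deriveB; apply: H1 => //; rewrite normr0.
  rewrite !subr0 => cs E1; have cd := le_lt_trans cs sd.
  have [x|k] := @mean_value (g1 c) (g12 c) 0 t.
    by rewrite !subr0 => xt; apply: H12 => //; exact: le_lt_trans td.
  rewrite !subr0 => kt E2.
  suff -> : s^-1 * (t^-1 * (g s t - g s 0) - t^-1 * (g 0 t - g 0 0)) = g12 c k.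
    by apply: Hr; [exact: le_lt_trans sr|exact: le_lt_trans tr].
  have E3 : g s t - g s 0 - (g 0 t - g 0 0) = s * (t * g12 c k).
    by move: E1 => /=; rewrite E2; lra.
  by rewrite -mulrBr E3; field; rewrite s0 t0.
rewrite add0r -[s *: 1]/(s * 1) mulr1.
have G2 x : `|x| < d -> (t^-1 * (g x t - g x 0)) @[t --> 0^'] --> g2 x.
  move=> xd.
  apply/cvgrPdist_le => e' e'0.
  have /is_derive_normP /(_ _ e'0) := H2 _ xd.
  by apply: filterS => h; rewrite distrC add0r -[h *: 1]/(h * 1) mulr1.
have cs := G2 _ sd.
have c0 : (t^-1 * (g 0 t - g 0 0)) @[t --> 0^'] --> g2 0 by apply: G2; rewrite normr0.
(* Let [t] tend to 0 with [s] fixed: the inner quotients become [g2 s] and [g2 0], and the bound of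
   [key] passes to the limit. *)
have cv :
    `|s^-1 * (t^-1 * (g s t - g s 0) - t^-1 * (g 0 t - g 0 0)) - g12 0 0|
      @[t --> 0^'] -->
    `|s^-1 * (g2 s - g2 0) - g12 0 0|.
  apply: cvg_norm; apply: cvgB; last exact: cvg_cst.
  by apply: cvgMr; apply: cvgB.
apply: (cvgr_to_le cv).
near=> t; apply: key.
- by near: t; exact: nbhs_dnbhs_neq.
- by near: t; exact: dnbhs0_lt.
- by near: t; exact: dnbhs0_lt.
Unshelve. all: by end_near. Qed.

(** The difference quotient at 0 is [k h] itself, so continuity of [k] suffices. Below, [k] is a
    second derivative of [F], which is merely continuous. *)
Lemma is_derive_idM (k : R -> R) : {for 0, continuous k} ->
  is_derive (0 : R) 1 (fun t => t * k t) (k 0).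
Proof.
move=> ck; apply/is_derive_normP => e e0.
have /cvgrPdist_le /(_ _ e0) ke : k t @[t --> 0^'] --> k 0.
  by apply: cvg_trans ck; apply: cvg_app; exact: cvg_within.
near=> h.
have h0 : h != 0 by near: h; exact: nbhs_dnbhs_neq.
rewrite add0r [h%:A]mulr1 mul0r subr0 mulKf// distrC.
by near: h.
Unshelve. all: by end_near. Qed.

End DirectionalDerivatives.

(** * Calculus of [CkOn] functions *)

Section CkFunctions.
Variables (R : realType) (V : normedModType R).
Implicit Types (U : set V) (f : V -> R) (u w x : V).

Lemma CkOn_continuous k U f x : CkOn k U f -> U x -> {for x, continuous f}.
Proof. by case: k => [|k] /=; [exact|move=> [+ _]; exact]. Qed.

Lemma CkOnS_is_derive k U f u x :
  CkOn k.+1 U f -> U x -> is_derive x u f ('D_u f x).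
Proof. by move=> [_ [+ _]] Ux => /(_ u x Ux) /derivableP. Qed.

Lemma CkOnS_derive k U f u : CkOn k.+1 U f -> CkOn k U ('D_u f).
Proof. by move=> [_ [_]]; exact. Qed.

(** [CkOn] speaks of directional derivatives only, so their additivity in the direction has to be
    derived from continuity of the first derivatives. *)
Lemma CkOn1_deriveD k U f u w x : open U -> CkOn k.+1 U f -> U x ->
  'D_(u + w) f x = 'D_u f x + 'D_w f x.
Proof.
move=> oU Cf Ux; apply: derive_val; apply: (@is_deriveDdir _ _ f ('D_w f)).
- exact: CkOnS_is_derive Cf Ux.
- apply: filterS (open_nbhs_nbhs (conj oU Ux)) => y Uy.
  exact: CkOnS_is_derive Cf Uy.
- by apply: CkOn_continuous Ux; exact: CkOnS_derive Cf.
Qed.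

Lemma CkOn1_deriveZ k U f u x (c : R) : CkOn k.+1 U f -> U x ->
  'D_(c *: u) f x = c * 'D_u f x.
Proof.
by move=> Cf Ux; apply: derive_val; apply: is_deriveZdir; exact: CkOnS_is_derive Cf Ux.
Qed.

End CkFunctions.

(** * Two-parameter surfaces and Schwarz's theorem *)

Section Surfaces.
Variables (R : realType).

Lemma near_surface {T : topologicalType} (c : R -> R -> T) (P : T -> Prop) :
  {for (0, 0), continuous (fun q : R * R => c q.1 q.2)} ->
  (\forall y \near c 0 0, P y) ->
  exists2 r : R, 0 < r & forall s t, `|s| < r -> `|t| < r -> P (c s t).
Proof.
move=> cc Pn; have /nbhs_ballP[r /= r0 H] := cc _ Pn.
exists r => // s t sr tr; apply: (H (s, t)).
by split; rewrite -ball_normE /= sub0r normrN.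
Qed.

Lemma continuous_surface (c : R -> R -> R) :
  {for (0, 0), continuous (fun q : R * R => c q.1 q.2)} ->
  forall e, 0 < e -> exists2 r : R, 0 < r &
     forall s t, `|s| < r -> `|t| < r -> `|c s t - c 0 0| <= e.
Proof.
move=> cc e e0; apply: (@near_surface _ _ (fun y => `|y - c 0 0| <= e)) => //.
have /cvgrPdist_le /(_ _ e0) : (y : R) @[y --> c 0 0] --> c 0 0 by exact: cvg_id.
by apply: filterS => y; rewrite distrC.
Qed.

Lemma continuous_line {V : normedModType R} (x v : V) :
  continuous (fun t : R => x + t *: v).
Proof.
move=> t; apply: cvgD; first exact: cvg_cst.
by apply: cvgZr_tmp; exact: cvg_id.
Qed.

Lemma continuous_plane {V : normedModType R} (x u w : V) :
  continuous (fun q : R * R => x + q.1 *: u + q.2 *: w).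
Proof.
move=> q; apply: cvgD; last by apply: cvgZr_tmp; exact: cvg_snd.
apply: cvgD; first exact: cvg_cst.
by apply: cvgZr_tmp; exact: cvg_fst.
Qed.

(** Restrict [f] to the surface [x + s u + t w] and apply [strong_schwarz] at the origin. *)
Lemma schwarz {V : normedModType R} k (U : set V) (f : V -> R) (u w x : V) :
  open U -> CkOn k.+2 U f -> U x -> 'D_u ('D_w f) x = 'D_w ('D_u f) x.
Proof.
move=> oU Cf Ux.
have cp := @continuous_plane V x u w.
have [|d d0 Hd] := @near_surface _ (fun s t => x + s *: u + t *: w) U (cp (0, 0)).
  by rewrite !scale0r !addr0; exact: open_nbhs_nbhs.
pose g12 s t := 'D_w ('D_u f) (x + s *: u + t *: w).
have g12E : g12 0 0 = 'D_w ('D_u f) x by rewrite /g12 !scale0r !addr0.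
suff H : is_derive (0 : R) 1 (fun s : R => 'D_w f (x + s *: u)) (g12 0 0).
  by apply: derive_val; apply/is_derive_line0P; rewrite -g12E.
apply: (@strong_schwarz _ (fun s t => f (x + s *: u + t *: w))
  (fun s t => 'D_u f (x + s *: u + t *: w)) g12 _ d d0).
- move=> s t sd td /=.
  have -> : (fun s : R => f (x + s *: u + t *: w)) = (fun s : R => f ((x + t *: w) + s *: u)).
    by apply/funext => r; rewrite addrAC.
  apply/(is_derive_lineP f (x + t *: w) u s); rewrite addrAC.
  by apply: CkOnS_is_derive Cf _; exact: Hd.
- move=> s t sd td /=.
  apply/(is_derive_lineP ('D_u f) (x + s *: u) w t).
  by apply: (CkOnS_is_derive w (CkOnS_derive u Cf)); exact: Hd.
- move=> s sd; apply/(is_derive_line0P f (x + s *: u) w).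
  apply: CkOnS_is_derive Cf _.
  have := Hd s 0 sd; rewrite scale0r addr0 normr0.
  by apply.
apply: continuous_surface.
apply: (@continuous_comp _ _ _ (fun q : R * R => x + q.1 *: u + q.2 *: w)
  ('D_w ('D_u f))); first exact: cp.
apply: (CkOn_continuous (CkOnS_derive w (CkOnS_derive u Cf))).
by rewrite /= !scale0r !addr0.
Qed.

End Surfaces.

(** * Hamel's condition and the vertical Hessian *)

Section Products.
Variables (R : realType) (V W : normedModType R).
Implicit Types (f : V * W -> R).

(** Partial derivatives become derivatives along [(a, 0)] and [(0, a)], so that [CkOn] and [schwarz]
    can be used on the product space. *)
Lemma is_derive_sliceLP f x y a l :
  is_derive x a (fun x => f (x, y)) l <-> is_derive (x, y) (a, 0) f l.
Proof.
rewrite !is_derive_normP.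
have E h : (x, y) + h *: (a, 0 : W) = (x + h *: a, y) :> V * W.
  by congr (_, _); rewrite /= scaler0 addr0.
by split=> H e /H; apply: filterS => h; rewrite E.
Qed.

Lemma is_derive_sliceRP f x y a l :
  is_derive y a (fun y => f (x, y)) l <-> is_derive (x, y) (0, a) f l.
Proof.
rewrite !is_derive_normP.
have E h : (x, y) + h *: (0 : V, a) = (x, y + h *: a) :> V * W.
  by congr (_, _); rewrite /= scaler0 addr0.
by split=> H e /H; apply: filterS => h; rewrite E.
Qed.

Lemma derive_sliceL f x y a : 'D_a (fun x => f (x, y)) x = 'D_(a, 0) f (x, y).
Proof.
rewrite /derive; apply: (congr1 (fun g : R -> R => lim (g @ 0^'))).
apply/funext => h /=.
by congr (_ *: (f _ - _)); congr (_, _) => /=; rewrite scaler0 add0r.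
Qed.

Lemma derive_sliceR f x y a : 'D_a (fun y => f (x, y)) y = 'D_(0, a) f (x, y).
Proof.
rewrite /derive; apply: (congr1 (fun g : R -> R => lim (g @ 0^'))).
apply/funext => h /=.
by congr (_ *: (f _ - _)); congr (_, _) => /=; rewrite scaler0 add0r.
Qed.

End Products.

Lemma derive_periodic (R : realType) (V : normedModType R) (f : V -> R) (m u : V) :
  (forall x, f (x + m) = f x) -> forall x, 'D_u f (x + m) = 'D_u f x.
Proof.
move=> fm x; rewrite /derive; apply: (congr1 (fun g : R -> R => lim (g @ 0^'))).
apply/funext => h /=.
by rewrite addrA !fm.
Qed.

(** Euler's relation: along the ray, [f (v + s v) = (1 + s) f v] as long as [1 + s] is positive. *)
Lemma is_derive_radial (R : realType) (V : normedModType R) (f : V -> R) (v : V) :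
  (forall c : R, 0 < c -> f (c *: v) = c * f v) -> is_derive v v f (f v).
Proof.
move=> fv; apply/is_derive_line0P.
have H : is_derive (0 : R) 1 (fun s : R => (1 + s) * f v) (f v).
  by apply: is_derive_eq; rewrite scaler0 !add0r [_%:A]mulr1.
apply: near_eq_is_derive H; near=> s.
have s1 : `|s : R| < 1.
  by near: s; apply: (@nbhs0_lt R R).
rewrite -{2}[v]scale1r -scalerDl fv//.
by move: s1; rewrite ltr_norml => /andP[]; lra.
Unshelve. all: by end_near. Qed.

Lemma row2E (R : realType) (a : 'rV[R]_2) :
  a = a 0 0 *: ebase R 0 + a 0 1 *: ebase R 1.
Proof.
rewrite [LHS]row_sum_delta big_ord_recl big_ord1.
by have -> : lift ord0 ord0 = 1 :> 'I_2 by exact/val_inj.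
Qed.

(* In dimension two an alternating bilinear form is determined by its values on one
   nonzero vector. *)
Lemma bilinear2_sym (R : realType) (M : 'rV[R]_2 -> 'rV[R]_2 -> R) (v : 'rV[R]_2) :
  (forall a b, M a b = a 0 0 * M (ebase R 0) b + a 0 1 * M (ebase R 1) b) ->
  (forall a b, M a b = b 0 0 * M a (ebase R 0) + b 0 1 * M a (ebase R 1)) ->
  v != 0 -> (forall a, M v a = M a v) -> forall a b, M a b = M b a.
Proof.
move=> Ml Mr v0 rad a b.
suff H : M (ebase R 0) (ebase R 1) = M (ebase R 1) (ebase R 0).
  rewrite (Ml a) (Mr _ b) (Mr (ebase R 1) b) (Ml b) (Mr _ a) (Mr (ebase R 1) a) H; ring.
(* Expanded in the basis, each relation has the same diagonal term on both sides. What remains is a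
   coordinate of [v] times the desired equality, and one coordinate is nonzero. *)
have r1 := rad (ebase R 0); have r0 := rad (ebase R 1).
rewrite (Ml v) (Mr _ v) in r0; rewrite (Ml v) (Mr _ v) in r1.
have [v00|v00] := eqVneq (v 0 0) 0; last first.
  by apply: (mulfI v00); move: r0; lra.
have v10 : v 0 1 != 0.
  by apply: contra_neq v0 => v10; rewrite (row2E v) v00 v10 !scale0r addr0.
by apply: (mulfI v10); move: r1; lra.
Qed.

Section Finsler.
Variables (R : realType) (F : 'rV[R]_2 -> 'rV[R]_2 -> R).
Hypothesis F_C2 : finsler_C2 F.
Hypothesis F_proj : projective F.

Notation E := ('rV[R]_2 * 'rV[R]_2)%type.
Let Phi (p : E) : R := F p.1 p.2.
Let U : set E := [set p : E | p.2 != 0].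

Let C2 : CkOn 2 U Phi. Proof. by case: F_C2. Qed.

Let C1 u : CkOn 1 U ('D_u Phi). Proof. exact: CkOnS_derive C2. Qed.

Lemma open_slit : open U.
Proof.
have -> : U = (fun p : E => p.2) @^-1` (~` [set 0]).
  by apply/seteqP; split=> p /=; move/eqP.
apply: open_comp; first by move=> p _; exact: cvg_snd.
by rewrite openC; apply: accessible_closed_set1; exact: hausdorff_accessible.
Qed.

Lemma slit_linear (f : E -> R) (u w : E) k (p : E) (a b : R) : CkOn k.+1 U f -> U p ->
  'D_(a *: u + b *: w) f p = a * 'D_u f p + b * 'D_w f p.
Proof.
by move=> Cf Up; rewrite (CkOn1_deriveD _ _ open_slit Cf Up) !(CkOn1_deriveZ _ _ Cf Up).
Qed.

Lemma vertical_decomp (f : E -> R) (a : 'rV[R]_2) k (p : E) : CkOn k.+1 U f -> U p ->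
  'D_(0, a) f p = a 0 0 * 'D_(0, ebase R 0) f p + a 0 1 * 'D_(0, ebase R 1) f p.
Proof.
move=> Cf Up; rewrite -(slit_linear _ _ _ _ Cf Up).
by congr ('D_(_) f p); congr (_, _); rewrite /= ?scaler0 ?addr0// -row2E.
Qed.

Lemma horizontal_decomp (f : E -> R) (a : 'rV[R]_2) k (p : E) : CkOn k.+1 U f -> U p ->
  'D_(a, 0) f p = a 0 0 * 'D_(ebase R 0, 0) f p + a 0 1 * 'D_(ebase R 1, 0) f p.
Proof.
move=> Cf Up; rewrite -(slit_linear _ _ _ _ Cf Up).
by congr ('D_(_) f p); congr (_, _); rewrite /= ?scaler0 ?addr0// -row2E.
Qed.

(** [projective] concerns basis directions; both sides are linear in [a]. *)
Lemma euler_lagrange (x v a : 'rV[R]_2) (t : R) : v != 0 ->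
  is_derive t 1 (fun s : R => 'D_(0, a) Phi (x + s *: v, v))
    ('D_(a, 0) Phi (x + t *: v, v)).
Proof.
move=> v0.
have H i : is_derive t 1 (fun s : R => 'D_(0, ebase R i) Phi (x + s *: v, v))
    ('D_(ebase R i, 0) Phi (x + t *: v, v)).
  rewrite -derive_sliceL.
  have -> : (fun s : R => 'D_(0, ebase R i) Phi (x + s *: v, v)) =
    (fun s : R => derive (F (x + s *: v)) v (ebase R i)).
    by apply/funext => s; rewrite -derive_sliceR.
  exact: F_proj.
have -> : (fun s : R => 'D_(0, a) Phi (x + s *: v, v)) = 
  (fun s : R => a 0 0 * 'D_(0, ebase R 0) Phi (x + s *: v, v) +
    a 0 1 * 'D_(0, ebase R 1) Phi (x + s *: v, v)).
  by apply/funext => s; exact: vertical_decomp C2 _.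
rewrite (@horizontal_decomp _ _ _ (x + t *: v, v) C2 v0).
have H0 := H 0; have H1 := H 1.
by apply: is_derive_eq.
Qed.

Lemma minkowski_homog (x v : 'rV[R]_2) (c : R) : 0 < c -> Phi (x, c *: v) = c * Phi (x, v).
Proof. by move=> c0; case: F_C2 => _ _ /(_ x) [_ [_ [H _]]]; exact: H. Qed.

Lemma horizontal_homog (x a v : 'rV[R]_2) (c : R) : v != 0 -> 0 < c ->
  'D_(a, 0) Phi (x, c *: v) = c * 'D_(a, 0) Phi (x, v).
Proof.
move=> v0 c0; rewrite -!derive_sliceL.
have -> : (fun x => Phi (x, c *: v)) = (fun x => c * Phi (x, v)).
  by apply/funext => y; exact: minkowski_homog.
have [dP _] : is_derive x a (fun x => Phi (x, v)) ('D_(a, 0) Phi (x, v)).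
  by apply/is_derive_sliceLP; exact: CkOnS_is_derive C2 _.
exact: (deriveZ c dP).
Qed.

(** Both sides equal ['D_(a, 0) Phi (x, v)]: the left one by the Euler-Lagrange equation at time 0,
    the right one by Euler's relation, since the horizontal derivative is homogeneous in [v]. *)
Lemma hamel_radial (x a v : 'rV[R]_2) : v != 0 ->
  'D_(v, 0) ('D_(0, a) Phi) (x, v) = 'D_(0, v) ('D_(a, 0) Phi) (x, v).
Proof.
move=> v0; transitivity ('D_(a, 0) Phi (x, v)).
  apply: derive_val; apply/is_derive_line0P.
  have -> : (fun s : R => 'D_(0, a) Phi ((x, v) + s *: (v, 0))) =
      (fun s : R => 'D_(0, a) Phi (x + s *: v, v)).
    apply/funext => s; have -> // : (x, v) + s *: (v, 0) = (x + s *: v, v) :> E.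
    by congr (_, _); rewrite /= scaler0 addr0.
  by have := euler_lagrange x a 0 v0; rewrite scale0r addr0.
apply/esym/derive_val/is_derive_sliceRP.
apply: (@is_derive_radial _ _ (fun w => 'D_(a, 0) Phi (x, w))) => c c0.
exact: horizontal_homog.
Qed.

(** By [hamel_radial] and Schwarz, [v] lies in the radical of the alternating part of the mixed
    second derivative, and in dimension two this forces symmetry. *)
Lemma hamel (x a b v : 'rV[R]_2) : v != 0 ->
  'D_(a, 0) ('D_(0, b) Phi) (x, v) = 'D_(b, 0) ('D_(0, a) Phi) (x, v).
Proof.
move=> v0; have Up : U (x, v) by [].
pose M (a b : 'rV[R]_2) := 'D_(a, 0) ('D_(0, b) Phi) (x, v).
have S a' b' : M a' b' = 'D_(0, b') ('D_(a', 0) Phi) (x, v).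
  exact: (schwarz _ _ open_slit C2 Up).
have Ml a' b' : M a' b' = a' 0 0 * M (ebase R 0) b' + a' 0 1 * M (ebase R 1) b'.
  exact: (horizontal_decomp _ (C1 _) Up).
have Mr a' b' : M a' b' = b' 0 0 * M a' (ebase R 0) + b' 0 1 * M a' (ebase R 1).
  by rewrite !S; exact: (vertical_decomp _ (C1 _) Up).
have rad a' : M v a' = M a' v by rewrite [RHS]S; exact: hamel_radial.
change (M a b = M b a); exact: (bilinear2_sym Ml Mr v0 rad).
Qed.

Lemma slit_near (x b v : 'rV[R]_2) : v != 0 -> exists2 d : R, 0 < d &
  forall e : R, `|e| < d -> v + e *: b != 0.
Proof.
move=> v0; have cl := @continuous_line R _ (x, v) (0, b).
have : \forall e \near 0, U ((x, v) + e *: (0, b)).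
  apply: cl; rewrite scale0r addr0; apply: open_nbhs_nbhs; split => //.
  exact: open_slit.
move=> /nbhs_ballP[d /= d0 H]; exists d => // e ed.
by apply: (H e); rewrite -ball_normE /= sub0r normrN.
Qed.

(** Differentiate the Euler-Lagrange equation in the velocity, in direction [b]. At [e = 0] the
    [e]-derivative of [X] along the varied lines is [s * k s + h s]; its derivative at [s = 0] is
    ['D_(0, b) Y (x, v)], which Schwarz and Hamel identify with [k 0]. The term [s * k s] also has
    derivative [k 0], so [h] has derivative 0. *)
Lemma vertical_hessian_line0 (x v a b : 'rV[R]_2) : v != 0 ->
  is_derive (0 : R) 1
    (fun t : R => 'D_(0, b) ('D_(0, a) Phi) (x + t *: v, v)) 0.
Proof.
move=> v0.
have [d d0 Hd] := slit_near x b v0.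
pose X := 'D_(0, a) Phi; pose Y := 'D_(a, 0) Phi.
(* For fixed [e] this is a line with its velocity [v + e b], so Euler-Lagrange applies in [s]; for
   fixed [s] it is a line in the product with direction [(s b, b)]. *)
pose c (s e : R) : E := (x + s *: (v + e *: b), v + e *: b).
pose g12 (s e : R) : R := s * 'D_(b, 0) Y (c s e) + 'D_(0, b) Y (c s e).
pose k (s : R) : R := 'D_(b, 0) X (x + s *: v, v).
pose h (s : R) : R := 'D_(0, b) X (x + s *: v, v).
have cE s e : c s e = (x + s *: v, v) + e *: (s *: b, b).
  by congr (_, _); rewrite /= scalerDr !scalerA addrA [s * e]mulrC.
have dirE s : (s *: b, b) = s *: (b, 0) + 1 *: (0, b) :> E.
  by congr (_, _); rewrite /= ?scaler0 ?addr0 ?add0r ?scale1r.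
have dir (f : E -> R) s p : CkOn 1 U f -> U p ->
    is_derive p (s *: b, b) f (s * 'D_(b, 0) f p + 'D_(0, b) f p).
  move=> Cf Up; have := CkOnS_is_derive (s *: b, b) Cf Up.
  by rewrite {2}dirE (slit_linear _ _ _ _ Cf Up) mul1r.
have cc : continuous (fun q : R * R => c q.1 q.2).
  have cb : continuous (fun q : R * R => v + q.2 *: b).
    by move=> q; apply: cvgD; [exact: cvg_cst|apply: cvgZr_tmp; exact: cvg_snd].
  have ca : continuous (fun q : R * R => x + q.1 *: (v + q.2 *: b)).
    move=> q; apply: cvgD; first exact: cvg_cst.
    by apply: cvgZ; [exact: cvg_fst|exact: cb].
  by move=> q; exact: (cvg_pair (ca q) (cb q)).
(* Since [X] is only [C^1], the differentiability of [s * k s + h s] is not known beforehand;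
   [strong_schwarz] supplies it. *)
have H : is_derive (0 : R) 1 (fun s => s * k s + h s) (g12 0 0).
  apply: (@strong_schwarz _ (fun s e => X (c s e)) (fun s e => Y (c s e)) g12 _ d d0).
  - by move=> s e sd ed; apply: euler_lagrange; exact: Hd.
  - move=> s e sd ed.
    have -> : (fun e => Y (c s e)) = (fun e => Y ((x + s *: v, v) + e *: (s *: b, b))).
      by apply/funext => r; rewrite cE.
    have := dir Y s _ (C1 _) (Hd e ed : U (c s e)).
    by rewrite {1}cE => /is_derive_lineP.
  - move=> s sd.
    have -> : (fun e => X (c s e)) = (fun e => X ((x + s *: v, v) + e *: (s *: b, b))).
      by apply/funext => r; rewrite cE.
    apply/(is_derive_line0P X (x + s *: v, v) (s *: b, b)).
    by apply: dir; [exact: C1|].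
  apply: continuous_surface.
  have cY u : {for (0, 0), continuous (fun q : R * R => 'D_u Y (c q.1 q.2))}.
    apply: (@continuous_comp _ _ _ (fun q : R * R => c q.1 q.2) ('D_u Y)); first exact: cc.
    apply: (CkOn_continuous (CkOnS_derive u (C1 _))).
    by rewrite /U /c /= scale0r addr0.
  by apply: cvgD; [apply: cvgM; [exact: cvg_fst|exact: cY]|exact: cY].
have kc : {for 0, continuous k}.
  apply: (@continuous_comp _ _ _ (fun s : R => (x + s *: v, v)) ('D_(b, 0) X)).
    exact: (cvg_pair (@continuous_line R _ x v 0) (cvg_cst v)).
  by apply: (CkOn_continuous (CkOnS_derive (b, 0) (C1 _))).
have Hk := is_derive_idM kc.
have -> : (fun t : R => 'D_(0, b) X (x + t *: v, v)) =
    (fun s => s * k s + h s) - (fun s => s * k s).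
  by apply/funext => s; rewrite fctE addrC addKr.
have E1 : 'D_(0, b) Y (x, v) = 'D_(b, 0) X (x, v).
  exact: (etrans (esym (schwarz (a, 0) (0, b) open_slit C2 (v0 : U (x, v))))
    (hamel x a b v0)).
have E0 : g12 0 0 - k 0 = 0.
  by rewrite /g12 /k /c mul0r add0r !scale0r !addr0 E1 subrr.
exact: (is_derive_eq (is_deriveB H Hk) E0).
Qed.

(** Using the previous lemma at every base point [x + s v] makes the derivative vanish along the
    whole line. *)
Lemma vertical_hessian_line (x v a b : 'rV[R]_2) (t : R) : v != 0 ->
  'D_(0, b) ('D_(0, a) Phi) (x + t *: v, v) = 'D_(0, b) ('D_(0, a) Phi) (x, v).
Proof.
move=> v0; pose h (s : R) : R := 'D_(0, b) ('D_(0, a) Phi) (x + s *: v, v).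
have -> : 'D_(0, b) ('D_(0, a) Phi) (x, v) = h 0 by rewrite /h scale0r addr0.
apply: (@is_derive_0_is_cst _ h) => s.
have := vertical_hessian_line0 (x + s *: v) a b v0.
move=> /is_derive_normP H; apply/is_derive_normP => e /H; apply: filterS => r.
by rewrite /h !add0r [r%:A]mulr1 scalerDl addrA scale0r addr0.
Qed.

End Finsler.

(** * Functions invariant along lines and periodic *)

(* The slope is [r = p / q] with [p = n k + 1], [q = n ^ 2], for which
   [(1 - n k) p + k ^ 2 q = 1] is an explicit Bezout relation. *)
Lemma rational_slope_approx (R : realType) (alpha x0 x1 d : R) : 0 < d ->
  exists (j l : int) (r : R),
    `|r - alpha| < d /\ `|(x0 + j%:~R) * r + l%:~R - x1| < d.
Proof.
move=> d0.
have [n nd] : exists n : nat, 2 / d < n%:R.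
  by exists (Num.bound (2 / d)); apply: archi_boundP; rewrite divr_ge0// ltW.
have n0 : 0 < n%:R :> R by apply: lt_trans nd; rewrite divr_gt0.
have n1 : 1 <= n%:R :> R by rewrite ler1n -(ltr0n R).
have nn0 : n%:R != 0 :> R by rewrite gt_eqF.
have nd2 : 2 / n%:R < d by rewrite ltr_pdivrMr// mulrC -ltr_pdivrMr.
(* [k / n] is within [1 / n] of [alpha], and [r = k / n + 1 / n ^ 2]. *)
pose k := Num.floor (alpha * n%:R).
pose r : R := (n%:R * k%:~R + 1) / n%:R ^+ 2.
pose N := Num.floor (n%:R ^+ 2 * (x1 - x0 * r)).
have kle : k%:~R <= alpha * n%:R by exact: ge_floor.
have klt : alpha * n%:R < k%:~R + 1 by have := floorD1_gt (alpha * n%:R); rewrite intrD.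
have Nle : N%:~R <= n%:R ^+ 2 * (x1 - x0 * r) by exact: ge_floor.
have Nlt : n%:R ^+ 2 * (x1 - x0 * r) < N%:~R + 1.
  by have := floorD1_gt (n%:R ^+ 2 * (x1 - x0 * r)); rewrite intrD.
have V1 : n%:R^-1 <= 1 :> R by rewrite invf_le1.
have V0 : 0 < n%:R^-1 :> R by rewrite invr_gt0.
(* The Bezout coefficients times [N] give [j r + l = N / n ^ 2], and [N] is the floor that brings
   this within [1 / n ^ 2] of [x1 - x0 r]. *)
exists (N * (1 - n%:Z * k)), (N * k ^+ 2), r; split.
  have -> : r - alpha = n%:R^-1 * ((k%:~R - alpha * n%:R) + n%:R^-1) by rewrite /r; field.
  rewrite normrM gtr0_norm//; apply: le_lt_trans nd2.
  rewrite [leRHS]mulrC; apply: ler_wpM2l; rewrite ltW//.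
  by rewrite ltr_norml; apply/andP; split; lra.
have -> : (x0 + (N * (1 - n%:Z * k))%:~R) * r + (N * k ^+ 2)%:~R - x1 =
    (n%:R^-1 * n%:R^-1) * (N%:~R - n%:R ^+ 2 * (x1 - x0 * r)).
  rewrite [k ^+ 2]expr2 !(intrM, intrB) mulr1z -!pmulrn /r.
  by field.
rewrite normrM gtr0_norm ?mulr_gt0//; apply: le_lt_trans nd2.
have -> : 2 / n%:R = (n%:R^-1 * 1) * 2 :> R by rewrite mulr1 mulrC.
apply: ler_pM => //.
  by apply: ler_wpM2l; rewrite // ltW.
by rewrite ltW// ltr_norml; apply/andP; split; lra.
Qed.

Section LineInvariant.
Variables (R : realType).
Notation E := ('rV[R]_2 * 'rV[R]_2)%type.
Notation e0 := (ebase R 0).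
Notation e1 := (ebase R 1).

Lemma row2P (a b : 'rV[R]_2) : a 0 0 = b 0 0 -> a 0 1 = b 0 1 -> a = b.
Proof. by move=> h0 h1; rewrite (row2E a) (row2E b) h0 h1. Qed.

Lemma ebaseE : ((e0 0 0 = 1) * (e0 0 1 = 0) * (e1 0 0 = 0) * (e1 0 1 = 1))%type.
Proof. by rewrite !mxE. Qed.

Lemma row2_neq0 (v : 'rV[R]_2) : v 0 0 != 0 -> v != 0.
Proof. by apply: contra_neq => ->; rewrite mxE. Qed.

(** Arbitrarily close to [(x, v)] there is a pair [(x', w)] such that a lattice translate of [x']
    lies on the line through 0 with direction [w]. There [g (x', w) = g (0, w)], and continuity
    concludes. *)
Lemma line_invariant_periodic_cst (g : E -> R) :
  (forall x v : 'rV[R]_2, v != 0 -> {for (x, v), continuous g}) ->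
  (forall (x v : 'rV[R]_2) (t : R), v != 0 -> g (x + t *: v, v) = g (x, v)) ->
  (forall (j l : int) (x v : 'rV[R]_2), g (x + (j%:~R *: e0 + l%:~R *: e1), v) = g (x, v)) ->
  forall x v : 'rV[R]_2, v != 0 -> g (x, v) = g (0, v).
Proof.
move=> cg lg pg.
(* Continuity argument: equality at arbitrarily small perturbations of [x] along [y] and of [v]
   along [w] gives equality at [(x, v)]. *)
have surf (x v y w : 'rV[R]_2) : v != 0 ->
    (forall r : R, 0 < r -> exists s t : R, [/\ `|s| < r, `|t| < r &
       g (x + s *: y, v + t *: w) = g (0, v + t *: w)]) -> g (x, v) = g (0, v).
  move=> v0 H; apply/eqP; rewrite -subr_eq0 -normr_le0; apply/ler_addgt0Pr => e e0.
  pose c (s t : R) : R := g (x + s *: y, v + t *: w) - g (0, v + t *: w).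
  have cvw : continuous (fun q : R * R => v + q.2 *: w).
    by move=> q; apply: cvgD; [exact: cvg_cst|apply: cvgZr_tmp; exact: cvg_snd].
  have cxy : continuous (fun q : R * R => x + q.1 *: y).
    by move=> q; apply: cvgD; [exact: cvg_cst|apply: cvgZr_tmp; exact: cvg_fst].
  have cc : {for (0, 0), continuous (fun q : R * R => c q.1 q.2)}.
    apply: cvgB.
      apply: (@continuous_comp _ _ _ (fun q : R * R => (x + q.1 *: y, v + q.2 *: w)) g).
        exact: (cvg_pair (cxy _) (cvw _)).
      by rewrite /= !scale0r !addr0; exact: cg.
    apply: (@continuous_comp _ _ _ (fun q : R * R => ((0, v + q.2 *: w) : E)) g).
      exact: (cvg_pair (cvg_cst _) (cvw _)).
    by rewrite /= !scale0r !addr0; exact: cg.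
  have [r r0 Hr] := continuous_surface cc e0.
  have [s [t [sr tr E0]]] := H _ r0.
  have := Hr _ _ sr tr; rewrite {1}/c E0 subrr sub0r normrN add0r.
  by rewrite /c !scale0r !addr0.
have main (x v : 'rV[R]_2) : v 0 0 != 0 -> g (x, v) = g (0, v).
  move=> v00; have v0 := row2_neq0 v00.
  apply: (surf x v e1 e1) => // d d0.
  (* The second coordinate of [v] moves by [v 0 0] times the error in the slope, hence the rescaled
     tolerance. *)
  have M0 : 0 < 1 + `|v 0 0| by rewrite ltr_pwDl.
  have d'0 : 0 < d / (1 + `|v 0 0|) by rewrite divr_gt0.
  have [j [l [r [rd xd]]]] := rational_slope_approx (v 0 1 / v 0 0) (x 0 0) (x 0 1) d'0.
  have d'd : d / (1 + `|v 0 0|) <= d.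
    by rewrite ler_pdivrMr// mulrDr mulr1 lerDl mulr_ge0// ltW.
  exists ((x 0 0 + j%:~R) * r + l%:~R - x 0 1), (v 0 0 * r - v 0 1); split.
  - exact: lt_le_trans d'd.
  - have -> : v 0 0 * r - v 0 1 = (r - v 0 1 / v 0 0) * v 0 0 by field.
    rewrite normrM -(divfK (lt0r_neq0 M0) d).
    by apply: ltr_pM => //; rewrite ltrDr.
  set w := v + _ *: e1.
  have w0 : w 0 0 = v 0 0 by rewrite !mxE /= mulr0 addr0.
  have w1 : w 0 1 = v 0 0 * r by rewrite !mxE /= mulr1 addrC subrK.
  have wn0 : w != 0 by apply: row2_neq0; rewrite w0.
  rewrite -(lg 0 w ((x 0 0 + j%:~R) / v 0 0)) // add0r.
  (* After translation by [(j, - l)] the perturbed point is exactly the multiple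
     [(x 0 0 + j) / v 0 0] of [w]. *)
  rewrite -(pg j (- l)).
  congr (g (_, _)); apply: row2P; rewrite ![in LHS]mxE [in RHS]mxE [in RHS]mxE ?w0 ?w1 !mxE /=.
    by rewrite !mulr0 mulr1 !addr0; field.
  by rewrite !mulr0 !mulr1 add0r mulrNz; field.
move=> x v v0; have [v00|] := eqVneq (v 0 0) 0; last exact: main.
(* A vertical [v] has no slope; tilting it slightly towards [e0] reduces to [main]. *)
apply: (surf x v 0 e0) => // r r0.
exists 0, (r / 2); rewrite normr0 gtr0_norm ?divr_gt0//; split=> //.
  by rewrite ltr_pdivrMr// ltr_pMr// ltr1n.
rewrite scale0r addr0; apply: main; rewrite !mxE /= v00 add0r mulr1.
by rewrite gt_eqF// divr_gt0.
Qed.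

End LineInvariant.

(** * Homogeneous functions with equal Hessians *)

Section EqualHessians.
Variables (R : realType).
Notation e0 := (ebase R 0).
Notation e1 := (ebase R 1).
Let U : set 'rV[R]_2 := [set v | v != 0].

Lemma open_neq0 : open U.
Proof.
have -> : U = ~` [set 0].
  by apply/seteqP; split=> p /=; move/eqP.
by rewrite openC; apply: accessible_closed_set1; exact: hausdorff_accessible.
Qed.

Variables (f g : 'rV[R]_2 -> R).
Hypothesis f_C2 : CkOn 2 U f.
Hypothesis g_C2 : CkOn 2 U g.
Hypothesis f_homog : forall (c : R) v, 0 < c -> f (c *: v) = c * f v.
Hypothesis g_homog : forall (c : R) v, 0 < c -> g (c *: v) = c * g v.
Hypothesis fg_hessian : forall a b v : 'rV[R]_2, v != 0 ->
  'D_b ('D_a f) v = 'D_b ('D_a g) v.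

Let K (a v : 'rV[R]_2) : R := 'D_a f v - 'D_a g v.

Let K_line (a v w : 'rV[R]_2) :
  (forall s : R, v + s *: (w - v) != 0) -> K a v = K a w.
Proof.
move=> H.
have [s _|c _] := @mean_value_line _ _ (K a) (fun=> 0) v (w - v) 1.
  have Us : U (v + s *: (w - v)) by exact: H.
  have Hf := CkOnS_is_derive (w - v) (CkOnS_derive a f_C2) Us.
  have Hg := CkOnS_is_derive (w - v) (CkOnS_derive a g_C2) Us.
  by have := is_deriveB Hf Hg; rewrite (fg_hessian _ _ Us) subrr.
by rewrite mul0r scale1r subrKC => /eqP; rewrite subr_eq0 => /eqP ->.
Qed.

(** The second coordinate along the line from [v] to [e0] is [(1 - s) v 0 1]. It vanishes only at
    [s = 1], where the point is [e0], so the line avoids the origin. *)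
Let K_cst1 (a v : 'rV[R]_2) : v 0 1 != 0 -> K a v = K a e0.
Proof.
move=> v1; apply: K_line => s; have [->|s1] := eqVneq s 1.
  by rewrite scale1r subrKC; apply: row2_neq0; rewrite ebaseE oner_neq0.
apply: contra_neq s1 => /(congr1 (fun v : 'rV[R]_2 => v 0 1)).
rewrite !mxE /= sub0r mulrN -{1}[v 0 1]mul1r -mulrBl => /eqP.
by rewrite mulf_eq0 (negbTE v1) orbF subr_eq0 => /eqP ->.
Qed.

(** For [v] on the axis of [e0] the straight line to [e0] may meet the origin, so the path goes
    through [e1]. *)
Let K_cst (a v : 'rV[R]_2) : v != 0 -> K a v = K a e0.
Proof.
move=> v0; have [v1|] := eqVneq (v 0 1) 0; last exact: K_cst1.
have v00 : v 0 0 != 0.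
  by apply: contra_neq v0 => v00; rewrite (row2E v) v00 v1 !scale0r addr0.
have <- : K a e1 = K a e0 by apply: K_cst1; rewrite ebaseE oner_neq0.
apply: K_line => s; have [->|s1] := eqVneq s 1.
  rewrite scale1r subrKC; apply/eqP => /(congr1 (fun v : 'rV[R]_2 => v 0 1)).
  by rewrite ebaseE mxE; apply/eqP; rewrite oner_neq0.
apply: contra_neq s1 => /(congr1 (fun v : 'rV[R]_2 => v 0 0)).
rewrite !mxE /= sub0r mulrN -{1}[v 0 0]mul1r -mulrBl => /eqP.
by rewrite mulf_eq0 (negbTE v00) orbF subr_eq0 => /eqP ->.
Qed.

Let K_radial (v : 'rV[R]_2) : K v v = f v - g v.
Proof.
rewrite /K; congr (_ - _); apply: derive_val; apply: is_derive_radial => c.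
  exact: f_homog.
exact: g_homog.
Qed.

(** [K a v] is linear in [a] and constant in [v]. Each [K e_i] can therefore be evaluated at [e_i]
    itself, where Euler's relation gives [f e_i - g e_i]. *)
Lemma equal_hessians_derive (a v : 'rV[R]_2) : v != 0 ->
  'D_a f v - 'D_a g v = a 0 0 * (f e0 - g e0) + a 0 1 * (f e1 - g e1).
Proof.
move=> v0; have Uv : U v by [].
have [n0 n1] : e0 != 0 /\ e1 != 0.
  split; apply/eqP.
    by move/(congr1 (fun v : 'rV[R]_2 => v 0 0))/eqP; rewrite ebaseE mxE oner_eq0.
  by move/(congr1 (fun v : 'rV[R]_2 => v 0 1))/eqP; rewrite ebaseE mxE oner_eq0.
rewrite -!K_radial (K_cst e1 n1) -(K_cst e1 v0) -(K_cst e0 v0) {1 2}(row2E a) /K.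
rewrite (CkOn1_deriveD _ _ open_neq0 f_C2 Uv) (CkOn1_deriveD _ _ open_neq0 g_C2 Uv).
rewrite !(CkOn1_deriveZ _ _ f_C2 Uv) !(CkOn1_deriveZ _ _ g_C2 Uv).
ring.
Qed.

Lemma equal_hessians_linear (v : 'rV[R]_2) : v != 0 ->
  f v - g v = v 0 0 * (f e0 - g e0) + v 0 1 * (f e1 - g e1).
Proof. by move=> v0; rewrite -(equal_hessians_derive v v0) -K_radial. Qed.

End EqualHessians.

(** * Closed 1-forms on the plane *)

Lemma derive0_eq (R : realType) (f g df : R -> R) (b : R) :
  (forall x : R, `|x| <= `|b| -> is_derive x 1 f (df x)) ->
  (forall x : R, `|x| <= `|b| -> is_derive x 1 g (df x)) ->
  f b - f 0 = g b - g 0.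
Proof.
move=> Hf Hg.
have [x|c _] := @mean_value _ (fun x => f x - g x) (fun=> 0) 0 b.
  rewrite !subr0 => xb; have := is_deriveB (Hf _ xb) (Hg _ xb).
  by rewrite subrr.
by rewrite mul0r; lra.
Qed.

(** The integral from [- n] is a primitive to the right of [- n]. Subtracting its value at 0 makes
    these primitives agree where they overlap, so they glue to one on the whole line. *)
Lemma continuous_primitive (R : realType) (g : R -> R) : continuous g ->
  exists2 G : R -> R, G 0 = 0 & forall x : R, is_derive x 1 G (g x).
Proof.
move=> cg.
pose P (n : nat) (x : R) := (\int[lebesgue_measure]_(t in `[(- n%:R), x]) g t)%R.
have dP n (x : R) : - n%:R < x -> is_derive x 1 (P n) (g x).
  move=> nx.
  have xx1 : x < x + 1 by rewrite ltrDl.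
  have gi : (@lebesgue_measure R).-integrable `[(- n%:R), x + 1] (EFin \o g).
    apply: continuous_compact_integrable; first exact: segment_compact.
    exact: continuous_subspaceT.
  have [dx Ex] := continuous_FTC1_closed xx1 gi nx (cg x).
  by split; [exact: dx|rewrite -derive1E].
have PE n m x : `|x| < n%:R -> `|x| < m%:R -> P n x - P n 0 = P m x - P m 0.
  move=> xn xm; apply: (@derive0_eq _ _ _ g) => y yx; apply: dP.
    by have := le_lt_trans yx xn; rewrite ltr_norml => /andP[].
  by have := le_lt_trans yx xm; rewrite ltr_norml => /andP[].
pose n (x : R) := Num.bound `|x|.
have nP x : `|x| < (n x)%:R by exact: archi_boundP.
exists (fun x => P (n x) x - P (n x) 0); first by rewrite subrr.
(* This [m] serves every point within distance 1 of [x], so near [x] the glued function is a single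
   [P m - P m 0]. *)
move=> x; pose m := Num.bound (`|x| + 1).
have xm : `|x| + 1 < m%:R by apply: archi_boundP; rewrite addr_ge0.
have H : is_derive x 1 (fun y => P m y - P m 0) (g x).
  have xm' : - m%:R < x.
    by rewrite ltrNl; apply: le_lt_trans xm; rewrite (le_trans (ler_norm _))// normrN lerDl.
  by have := is_deriveB (dP m x xm') (is_derive_cst (P m 0) x 1); rewrite subr0.
apply: near_eq_is_derive H; near=> y; apply: PE => //.
apply: lt_trans xm; have : `|x - y| < 1 by near: y; exact: (@nbhsx_ballx _ R x 1 ltr01).
by have := lerB_dist y x; rewrite distrC; lra.
Unshelve. all: by end_near. Qed.

(** Differentiation under the integral sign, with integrals expressed through primitives: [Phi s] is
    the integral of [u s] from 0, and [v s] is a primitive of the parameter derivative [q s]. *)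
Lemma is_derive_primitive_param (R : realType) (Phi u v q : R -> R -> R) (s y : R) :
  (forall s t : R, is_derive t 1 (Phi s) (u s t)) ->
  (forall s, Phi s 0 = 0) ->
  (forall s t : R, is_derive s 1 (u^~ t) (q s t)) ->
  (forall s t : R, is_derive t 1 (v s) (q s t)) ->
  continuous (fun p : R * R => q p.1 p.2) ->
  is_derive s 1 (fun s : R => Phi s y) (v s y - v s 0).
Proof.
move=> dPhi Phi0 du dv cq; apply/is_derive_normP => e e0.
have y1 : 0 < `|y| + 1 by rewrite ltr_wpDl.
pose e' := e / (`|y| + 1).
have e'0 : 0 < e' by rewrite divr_gt0.
(* Compactness of the segment makes the continuity of [q] in the parameter uniform in [t]. *)
have tube : \forall h \near (0 : R),
    `[(- `|y|), `|y|] `<=` (fun t => `|q (s + h) t - q s t| <= e').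
  have /compact_near_coveringP K := @segment_compact R (- `|y|) `|y|.
  apply: (K R (nbhs (0 : R)) (fun h t => `|q (s + h) t - q s t| <= e')) => t _.
  pose d (p : R * R) := q (s + p.2) p.1 - q s p.1.
  have cd : {for (t, 0), continuous d}.
    apply: cvgB.
      apply: (@continuous_comp _ _ _ (fun p : R * R => (s + p.2, p.1)) (fun p => q p.1 p.2)).
        by apply: (cvg_pair (cvgD (cvg_cst _) cvg_snd) cvg_fst).
      exact: cq.
    apply: (@continuous_comp _ _ _ (fun p : R * R => (s, p.1)) (fun p => q p.1 p.2)).
      by apply: (cvg_pair (cvg_cst _) cvg_fst).
    exact: cq.
  have /cvgrPdist_le /(_ _ e'0) := cd.
  by apply: filterS => p; rewrite {1}/d addr0 subrr sub0r normrN.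
move/nbhs_ballP : tube => [r /= r0 tube].
near=> h.
have hr : `|h| < r by near: h; exact: dnbhs0_lt.
have h0 : h != 0 by near: h; exact: nbhs_dnbhs_neq.
have qle c t : `|c| <= `|h| -> `|t| <= `|y| -> `|q (s + c) t - q s t| <= e'.
  move=> ch ty; apply: (tube c).
    by rewrite -ball_normE /= sub0r normrN; exact: le_lt_trans hr.
  by rewrite /= in_itv /= -ler_norml.
rewrite [h%:A]mulr1.
(* The first-order error, which vanishes at [t = 0]. The mean value theorem in [t], then in the
   parameter, writes [K y] as [h y] times a variation of [q], which the tube bounds. *)
pose K t := Phi (s + h) t - Phi s t - h * (v s t - v s 0).
have dK (t : R) : is_derive t 1 K (u (s + h) t - u s t - h * q s t).
  have H1 := dPhi (s + h) t; have H2 := dPhi s t; have H3 := dv s t.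
  by apply: is_derive_eq; rewrite subr0.
have [c] := mean_value (fun t (_ : `|t - 0| <= `|y - 0|) => dK t).
rewrite !subr0 => cy; rewrite {2}/K !Phi0 !subrr mulr0 !subr0 => EK.
have [k] := mean_value (fun t (_ : `|t - s| <= `|s + h - s|) => du t c).
rewrite [s + h - s]addrC addKr => kh Eu.
have -> : h^-1 * (Phi (s + h) y - Phi s y) - (v s y - v s 0) = (q k c - q s c) * y.
  have : K y = h * ((q k c - q s c) * y) by rewrite EK /= Eu; ring.
  rewrite /K => /(congr1 (fun z => h^-1 * z)); rewrite mulKf// => <-.
  by field.
rewrite normrM; apply: (@le_trans _ _ (e' * `|y|)).
  by apply: ler_wpM2r => //; have := qle (k - s) c kh cy; rewrite [s + _]addrC subrK.
by rewrite /e' -mulrA ler_piMr ?ltW// mulrC ltr_pdivrMr// mul1r ltrDl.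
Unshelve. all: by end_near. Qed.

Section Plane.
Variable R : realType.
Notation e0 := (ebase R 0).
Notation e1 := (ebase R 1).

Lemma row_coord_le_norm (h : 'rV[R]_2) (i : 'I_2) : `|h 0 i| <= `|h|.
Proof.
rewrite [leRHS]/Num.norm /= mx_normrE.
by apply: (le_bigmax _ (fun k : 'I_1 * 'I_2 => `|h k.1 k.2|) (0, i)).
Qed.

Definition row2_form (a b : R) (v : 'rV[R]_2) : R := v 0 0 * a + v 0 1 * b.

Lemma row2_form_is_linear a b : linear (row2_form a b : 'rV[R]_2 -> R^o).
Proof. by move=> c u v; rewrite /row2_form !mxE -[c *: _]/(c * _); ring. Qed.

HB.instance Definition _ a b := GRing.isLinear.Build R 'rV[R]_2 R^o _
  (row2_form a b) (row2_form_is_linear a b).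

Lemma row2_form_continuous a b : continuous (row2_form a b).
Proof.
move=> v; have c i : (w : 'rV[R]_2) 0 i @[w --> v] --> v 0 i by exact: coord_continuous.
exact: (cvgD (cvgMr_tmp (b := a) (c 0)) (cvgMr_tmp (b := b) (c 1))).
Qed.

(** Split the increment into a step along [e0] and one along [e1]. By the mean value theorem and
    continuity of the partials, each contributes an error of at most [e / 2] times the norm of
    [h]. *)
Lemma continuous_partials_diff (f w0 w1 : 'rV[R]_2 -> R) (x : 'rV[R]_2) :
  (forall x, is_derive x e0 f (w0 x)) -> (forall x, is_derive x e1 f (w1 x)) ->
  continuous w0 -> continuous w1 ->
  differentiable f x /\ 'd f x = row2_form (w0 x) (w1 x) :> ('rV[R]_2 -> R).
Proof.
move=> d0 d1 c0 c1.
have H : f \o shift x = cst (f x) + row2_form (w0 x) (w1 x) +o_ (0 : 'rV[R]_2) id.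
  apply/eqaddoP => _ /posnumP[e].
  have cs (w : 'rV[R]_2 -> R) : continuous w -> exists2 r : R, 0 < r &
      forall s t : R, `|s| < r -> `|t| < r ->
      `|w (x + s *: e0 + t *: e1) - w x| <= e%:num / 2.
    move=> cw; have [||r r0 Hr] := @continuous_surface R
        (fun s t => w (x + s *: e0 + t *: e1)) _ (e%:num / 2).
    - apply: (@continuous_comp _ _ _ (fun q : R * R => x + q.1 *: e0 + q.2 *: e1) w).
        exact: continuous_plane.
      exact: cw.
    - by [].
    by exists r => // s t /Hr/[apply]; rewrite !scale0r !addr0.
  have [r0 r00 H0] := cs _ c0; have [r1 r10 H1] := cs _ c1.
  near=> h.
  have hr0 : `|h| < r0 by near: h; exact: (@nbhs0_lt R 'rV[R]_2).
  have hr1 : `|h| < r1 by near: h; exact: (@nbhs0_lt R 'rV[R]_2).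
  have hi i : `|h 0 i| <= `|h| by exact: row_coord_le_norm.
  have [s sh Es] := @mean_value_line _ _ f w0 x e0 (h 0 0) (fun s _ => d0 _).
  have [t th Et] := @mean_value_line _ _ f w1 (x + h 0 0 *: e0) e1 (h 0 1) (fun t _ => d1 _).
  have hE : h + x = x + h 0 0 *: e0 + h 0 1 *: e1 by rewrite {1}(row2E h) addrC addrA.
  rewrite [X in `|X|](_ : _ = (w0 (x + s *: e0) - w0 x) * h 0 0 +
    (w1 (x + h 0 0 *: e0 + t *: e1) - w1 x) * h 0 1); last first.
    by rewrite !fctE /= /row2_form hE; move: Es Et; lra.
  apply: le_trans (ler_normD _ _) _; rewrite !normrM /=.
  rewrite [leRHS](_ : _ = e%:num / 2 * `|h| + e%:num / 2 * `|h|); last first.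
    by rewrite -mulrDl -splitr.
  apply: lerD; apply: ler_pM => //.
    have := H0 s 0; rewrite scale0r addr0; apply; last by rewrite normr0.
    exact: le_lt_trans (le_trans sh (hi _)) hr0.
  apply: H1; first exact: le_lt_trans (hi _) hr1.
  exact: le_lt_trans (le_trans th (hi _)) hr1.
have E := diff_unique (@row2_form_continuous _ _) H.
split=> //; apply/diff_locallyP; rewrite E; split=> //.
exact: row2_form_continuous.
Unshelve. all: by end_near. Qed.

(** The potential integrates [w0] along the first axis, then [w1] vertically. Closedness turns the
    [e0]-derivative of the vertical integral into [w0 (pt s y) - w0 (pt s 0)], whose last term
    cancels the derivative of [A]. *)
Lemma closed_form_exact (w0 w1 : 'rV[R]_2 -> R) :
  CkOn 1 setT w0 -> CkOn 1 setT w1 -> (forall x, 'D_e1 w0 x = 'D_e0 w1 x) ->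
  exists f : 'rV[R]_2 -> R, forall x, differentiable f x /\
    forall v, 'd f x v = v 0 0 * w0 x + v 0 1 * w1 x.
Proof.
move=> C0 C1 closed.
have c0 : continuous w0 by move=> x; exact: (CkOn_continuous C0).
have c1 : continuous w1 by move=> x; exact: (CkOn_continuous C1).
pose pt (s t : R) : 'rV[R]_2 := s *: e0 + t *: e1.
have ptE (x : 'rV[R]_2) : pt (x 0 0) (x 0 1) = x by rewrite /pt -row2E.
have cpt : continuous (fun p : R * R => pt p.1 p.2).
  by move=> p; apply: cvgD; apply: cvgZr_tmp; [exact: cvg_fst|exact: cvg_snd].
have [A _ dA] : exists2 G : R -> R,
    G 0 = 0 & forall x : R, is_derive x 1 G (w0 (pt x 0)).
  apply: (@continuous_primitive R (fun x => w0 (pt x 0))) => x.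
  apply: (@continuous_comp _ _ _ (pt^~ 0) w0); last exact: c0.
  by apply: cvgD; [apply: cvgZr_tmp; exact: cvg_id|exact: cvg_cst].
have /choice[Phi HPhi] s : exists G : R -> R,
    G 0 = 0 /\ forall x : R, is_derive x 1 G (w1 (pt s x)).
  have [|G G0 dG] := @continuous_primitive R (fun x => w1 (pt s x)); last by exists G.
  move=> x; apply: (@continuous_comp _ _ _ (pt s) w1); last exact: c1.
  by apply: cvgD; [exact: cvg_cst|apply: cvgZr_tmp; exact: cvg_id].
pose f (x : 'rV[R]_2) := A (x 0 0) + Phi (x 0 0) (x 0 1).
exists f => x.
have dPhi (s y : R) : is_derive s 1 (fun s : R => Phi s y) (w0 (pt s y) - w0 (pt s 0)).
  apply: (@is_derive_primitive_param R Phi (fun s t => w1 (pt s t))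
    (fun s t => w0 (pt s t)) (fun s t => 'D_e0 w1 (pt s t))).
  - by move=> s' t; exact: (HPhi s').2.
  - by move=> s'; exact: (HPhi s').1.
  - move=> s' t.
    have -> : (fun s => w1 (pt s t)) = (fun s : R => w1 (t *: e1 + s *: e0)).
      by apply/funext => z; rewrite /pt addrC.
    have -> : pt s' t = t *: e1 + s' *: e0 by rewrite /pt addrC.
    by have /is_derive_lineP := CkOnS_is_derive e0 C1 (I : setT (t *: e1 + s' *: e0)).
  - move=> s' t; rewrite -closed.
    by have /is_derive_lineP := CkOnS_is_derive e1 C0 (I : setT (pt s' t)).
  - move=> p; apply: (@continuous_comp _ _ _ (fun p : R * R => pt p.1 p.2) ('D_e0 w1)).
      exact: cpt.
    exact: (CkOn_continuous (CkOnS_derive e0 C1)).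
have [] := @continuous_partials_diff f w0 w1 x; last by move=> df dE; split=> // v; rewrite dE.
- move=> z; apply/is_derive_line0P.
  have -> : (fun s : R => f (z + s *: e0)) =
      (fun s : R => A (s + z 0 0) + Phi (s + z 0 0) (z 0 1)).
    by apply/funext => s; rewrite /f !mxE /= mulr0 mulr1 addr0 [s + _]addrC.
  have H1 := dA (z 0 0); have H2 := dPhi (z 0 0) (z 0 1).
  have := is_deriveD H1 H2; rewrite ptE subrKC.
  move=> /is_derive_normP H; apply/is_derive_normP => e /H; apply: filterS => h.
  by rewrite !fctE /= !add0r [h%:A]mulr1 [h + _]addrC.
- move=> z; apply/is_derive_line0P.
  have -> : (fun s : R => f (z + s *: e1)) =
      (fun s : R => A (z 0 0) + Phi (z 0 0) (s + z 0 1)).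
    by apply/funext => s; rewrite /f !mxE /= mulr0 mulr1 addr0 [s + _]addrC.
  have := (HPhi (z 0 0)).2 (z 0 1); rewrite ptE.
  move=> /is_derive_normP H; apply/is_derive_normP => e /H; apply: filterS => h.
  by rewrite /= !add0r [h%:A]mulr1 [h + _]addrC opprD addrACA subrr add0r.
- exact: c0.
- exact: c1.
Qed.

End Plane.

(** * Periodic projective metrics *)

Lemma CkOnW (R : realType) (V : normedModType R) k (U : set V) (f : V -> R) :
  CkOn k.+1 U f -> CkOn k U f.
Proof.
elim: k f => [|k IH] f; first by case.
by move=> [cf [df Df]]; split=> //; split=> // u; exact/IH/Df.
Qed.

Lemma CkOn_cst (R : realType) (V : normedModType R) k (U : set V) (c : R) :
  CkOn k U (fun=> c).
Proof.
elim: k c => [|k IH] c /=; first by move=> x _; exact: cvg_cst.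
split; [by move=> x _; exact: cvg_cst|split=> [u x _|u]].
  exact: derivable_cst.
rewrite [X in CkOn _ _ X](_ : _ = fun=> 0); first exact: IH.
by apply/funext => x; exact: derive_cst.
Qed.

Lemma derive_subr_cst (R : realType) (V : normedModType R) (f : V -> R) (c : R) (u x : V) :
  'D_u (fun x => f x - c) x = 'D_u f x.
Proof.
rewrite /derive; apply: (congr1 (fun g : R -> R => lim (g @ 0^'))).
apply/funext => h /=.
by congr (_ *: _); rewrite opprB addrA subrK.
Qed.

Lemma CkOn_subr_cst (R : realType) (V : normedModType R) k (U : set V) (f : V -> R) (c : R) :
  CkOn k U f -> CkOn k U (fun x => f x - c).
Proof.
have cf : (forall x, U x -> {for x, continuous f}) ->
    forall x, U x -> {for x, continuous (fun x => f x - c)}.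
  by move=> H x Ux; apply: cvgB; [exact: H|exact: cvg_cst].
case: k => [|k] /=; first exact: cf.
move=> [/cf cf' [df Df]]; split; [exact: cf'|split=> u].
  by move=> x Ux; apply: derivableB; [exact: df|exact: derivable_cst].
rewrite [X in CkOn _ _ X](_ : _ = 'D_u f); first exact: Df.
by apply/funext => x; exact: derive_subr_cst.
Qed.

Lemma CkOn_slice (R : realType) (V W : normedModType R) k (U : set (V * W))
    (f : V * W -> R) (y : W) :
  (forall x, U (x, y)) -> CkOn k U f -> CkOn k setT (fun x => f (x, y)).
Proof.
move=> Uy; have cf (g : V * W -> R) : (forall p, U p -> {for p, continuous g}) ->
    forall x, setT x -> {for x, continuous (fun x => g (x, y))}.
  move=> H x _; apply: (@continuous_comp _ _ _ (fun x => (x, y)) g); last exact: H.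
  exact: (cvg_pair cvg_id (cvg_cst y)).
elim: k f => [|k IH] f /=; first exact: cf.
move=> [/cf cf' [df Df]]; split; [exact: cf'|split=> u].
  move=> x _; have /derivableP H := df (u, 0) (x, y) (Uy x).
  by have [] := proj2 (is_derive_sliceLP f x y u _) H.
rewrite [X in CkOn _ _ X](_ : _ = fun x => 'D_(u, 0) f (x, y)); first exact: (IH _ (Df _)).
by apply/funext => x; exact: derive_sliceL.
Qed.

Section PeriodicProjective.
Variables (R : realType) (F : 'rV[R]_2 -> 'rV[R]_2 -> R).
Hypothesis F_C2 : finsler_C2 F.
Hypothesis F_proj : projective F.
Hypothesis F_per : Zperiodic F.

Notation E := ('rV[R]_2 * 'rV[R]_2)%type.
Notation e0 := (ebase R 0).
Notation e1 := (ebase R 1).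
Let Phi (p : E) : R := F p.1 p.2.
Let U : set E := [set p : E | p.2 != 0].

Let C2 : CkOn 2 U Phi. Proof. by case: F_C2. Qed.

Let C2_fibre (x : 'rV[R]_2) : CkOn 2 [set v | v != 0] (F x).
Proof. by case: F_C2 => _ _ /(_ x) [_ [_ [_ [_ []]]]]. Qed.

Let homog (x : 'rV[R]_2) (c : R) (v : 'rV[R]_2) : 0 < c -> F x (c *: v) = c * F x v.
Proof. by case: F_C2 => _ _ /(_ x) [_ [_ [+ _]]]; exact. Qed.

Let F0 x : F x 0 = 0.
Proof. by case: F_C2 => _ _ /(_ x) [_ [/(_ 0) [_ +] _]]; exact. Qed.

Lemma lattice_periodic (j l : int) (p : E) :
  Phi (p + (j%:~R *: e0 + l%:~R *: e1, 0)) = Phi p.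
Proof.
have -> : (j%:~R *: e0 + l%:~R *: e1 : 'rV[R]_2) =
    map_mx (fun z : int => z%:~R) (\row_i (if i == 0 then j else l)).
  by apply: row2P; rewrite !mxE /= ?mulr0 ?mulr1 ?addr0 ?add0r.
by case: p => x v; rewrite /Phi /= addr0 F_per.
Qed.

(** The second vertical derivative inherits continuity and periodicity from [Phi] and is constant
    along lines, so [line_invariant_periodic_cst] applies. *)
Lemma vertical_hessian_cst (x v a b : 'rV[R]_2) : v != 0 ->
  'D_b ('D_a (F x)) v = 'D_b ('D_a (F 0)) v.
Proof.
move=> v0.
have slice y : 'D_b ('D_a (F y)) v = 'D_(0, b) ('D_(0, a) Phi) (y, v).
  rewrite -derive_sliceR; congr ('D_b _ v).
  by apply/funext => w; rewrite -derive_sliceR.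
pose g := 'D_(0, b) ('D_(0, a) Phi).
have cg (y w : 'rV[R]_2) : w != 0 -> {for (y, w), continuous g}.
  move=> w0; apply: (CkOn_continuous (CkOnS_derive (0, b) (CkOnS_derive (0, a) C2))).
  exact: w0.
have lg (y w : 'rV[R]_2) (t : R) : w != 0 -> g (y + t *: w, w) = g (y, w).
  by move=> w0; exact: (vertical_hessian_line F_C2 F_proj y a b t w0).
have pg (j l : int) (y w : 'rV[R]_2) :
    g (y + (j%:~R *: e0 + l%:~R *: e1), w) = g (y, w).
  have H := derive_periodic (0, b) (derive_periodic (0, a) (lattice_periodic j l)) (y, w).
  rewrite [RHS](esym H); congr (g (_, _)).
  by rewrite /= addr0.
by rewrite !slice; exact: (line_invariant_periodic_cst cg lg pg x v0).
Qed.

Lemma derive_fibre_diff (x a v : 'rV[R]_2) : v != 0 ->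
  'D_a (F x) v - 'D_a (F 0) v = a 0 0 * (F x e0 - F 0 e0) + a 0 1 * (F x e1 - F 0 e1).
Proof.
exact: (equal_hessians_derive (C2_fibre x) (C2_fibre 0) (homog x) (homog 0)
  (fun a b v => @vertical_hessian_cst x v a b)).
Qed.

Lemma fibre_diff (x v : 'rV[R]_2) :
  F x v - F 0 v = v 0 0 * (F x e0 - F 0 e0) + v 0 1 * (F x e1 - F 0 e1).
Proof.
have [->|v0] := eqVneq v 0; first by rewrite !F0 !mxE; ring.
exact: (equal_hessians_linear (C2_fibre x) (C2_fibre 0) (homog x) (homog 0)
  (fun a b v => @vertical_hessian_cst x v a b)).
Qed.

Lemma fibre_diff_C2 (v : 'rV[R]_2) : CkOn 2 setT (fun x => F x v - F 0 v).
Proof.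
(* The zero section lies outside [U], where [Phi] is known to be [C^2]; there the difference is
   constantly 0. *)
have [->|v0] := eqVneq v 0.
  rewrite [X in CkOn _ _ X](_ : _ = fun=> 0); first exact: CkOn_cst.
  by apply/funext => x; rewrite !F0 subrr.
by apply: CkOn_subr_cst; exact: (@CkOn_slice _ _ _ 2 U Phi).
Qed.

(** By [derive_fibre_diff], each coefficient equals, up to a constant, a vertical derivative of
    [Phi] at the same vector [e0], so closedness is Hamel's condition there. *)
Lemma fibre_diff_closed (x : 'rV[R]_2) :
  'D_e1 (fun x => F x e0 - F 0 e0) x = 'D_e0 (fun x => F x e1 - F 0 e1) x.
Proof.
have n0 : e0 != 0 by apply: row2_neq0; rewrite ebaseE oner_neq0.
have H i a : 'D_a (fun x => F x (ebase R i) - F 0 (ebase R i)) x =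
    'D_(a, 0) ('D_(0, ebase R i) Phi) (x, e0).
  rewrite -derive_sliceL.
  rewrite -(derive_subr_cst (fun x => 'D_(0, ebase R i) Phi (x, e0)) ('D_(ebase R i) (F 0) e0)).
  congr ('D_a _ x); apply/funext => y.
  rewrite -derive_sliceR (derive_fibre_diff y (ebase R i) n0).
  have /orP[/eqP->|/eqP->] : (i == 0) || (i == 1) by case: i => [[|[|]]].
    by rewrite !ebaseE mul1r mul0r addr0.
  by rewrite !ebaseE mul1r mul0r add0r.
rewrite !H; exact: hamel.
Qed.

(** The third order of regularity comes from ['D_u f x = F x u - F 0 u], which is already [C^2] in
    [x]. *)
Lemma periodic_projective_decomposition :
  exists f : 'rV[R]_2 -> R,
    CkOn 3 setT f /\ forall x v : 'rV[R]_2, F x v = F 0 v + 'd f x v.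
Proof.
have [f Hf] := closed_form_exact (CkOnW (fibre_diff_C2 e0))
  (CkOnW (fibre_diff_C2 e1)) fibre_diff_closed.
have dE x v : 'd f x v = F x v - F 0 v by rewrite (Hf x).2 -fibre_diff.
exists f; split=> [|x v]; last by rewrite dE subrKC.
split=> [x _|]; first exact/differentiable_continuous/(Hf x).1.
split=> [u x _|u]; first exact/diff_derivable/(Hf x).1.
rewrite [X in CkOn _ _ X](_ : _ = fun x => F x u - F 0 u); first exact: fibre_diff_C2.
by apply/funext => x; rewrite deriveE ?dE//; exact: (Hf x).1.
Qed.

End PeriodicProjective.

Theorem theorem3p3 (R : realType) (F : 'rV[R]_2 -> 'rV[R]_2 -> R) :
  finsler_C2 F -> projective F -> Zperiodic F ->
  exists (N : 'rV[R]_2 -> R) (f : 'rV[R]_2 -> R),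
    minkowski_norm N /\ CkOn 3 setT f /\
    forall x v : 'rV[R]_2, F x v = N v + 'd f x v.
Proof.
move=> F_C2 F_proj F_per.
have [f [f_C3 FE]] := periodic_projective_decomposition F_C2 F_proj F_per.
by exists (F 0), f; split=> //; case: F_C2.
Qed.
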